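(* Let $G$ be a non-periodic soluble group. Then $G$ belongs to the class $\mathcal S$ if and only if $G$ is nilpotent.
   Context: $\mathcal S$ denotes the class of all groups $G$ such that every non-nilpotent subgroup $H \le G$ satisfies $N_G(H) = H$. A group is periodic if every element has finite order; groups may be infinite. *)

(* Defs.v *)
From HB Require Import structures.
From mathcomp Require Import all_boot.
From mathcomp Require Import boolp classical_sets.

Set Implicit Arguments.
Unset Strict Implicit.
Unset Printing Implicit Defensive.

Local Open Scope classical_set_scope.
Local Open Scope group_scope.

(* Groups are MathComp's possibly infinite [groupType]s, and subgroups are
   classical sets closed under the group operations: the theory of
   [{group gT}] is restricted to finite groups. *)

Section SubgroupTheory.
Variable G : groupType.
Implicit Types A B H : set G.

Definition subgroup H : Prop := group_closed [in H].

Definition generated A : set G := smallest subgroup A.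

Definition commutator_subgroup A B : set G :=
  generated [set [~ a, b] | a in A & b in B].

(* An equality, not an inclusion: in an infinite group the conjugate of H by g
   may be a proper subset of H. *)
Definition normalizer H : set G := [set g | [set h ^ g | h in H] = H].

Fixpoint lower_central_series H (n : nat) : set G :=
  if n is m.+1 then commutator_subgroup (lower_central_series H m) H else H.

Fixpoint derived_series H (n : nat) : set G :=
  if n is m.+1 then
    commutator_subgroup (derived_series H m) (derived_series H m)
  else H.

Definition nilpotent_subgroup H : Prop :=
  exists n : nat, lower_central_series H n = [set 1].

Definition soluble_subgroup H : Prop :=
  exists n : nat, derived_series H n = [set 1].

End SubgroupTheory.

Definition nilpotent_group (G : groupType) : Prop :=
  nilpotent_subgroup [set: G].

Definition soluble_group (G : groupType) : Prop :=
  soluble_subgroup [set: G].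

Definition periodic_group (G : groupType) : Prop :=
  forall x : G, exists2 n : nat, (0 < n)%N & x ^+ n = 1.

Definition class_S (G : groupType) : Prop :=
  forall H : set G, subgroup H -> ~ nilpotent_subgroup H -> normalizer H = H.

(* Main.v *)
From HB Require Import structures.
Require Import Defs.
From mathcomp Require Import all_boot all_algebra.
From mathcomp Require Import boolp classical_sets.
From mathcomp Require Import ring.

(** Let G be a soluble group in S which is not nilpotent. Proper normal
    subgroups of G are nilpotent, in particular G' is, and by Fitting's theorem
    G/G' is not the sum of two proper subgroups; hence G/G' is a p-group for
    some prime p. Let V be the quotient of G'/G'' by its torsion. An element x
    of G acts on V as an automorphism 1 + u of order dividing q = p^k. For v in
    V, let H be generated by x and the preimage of Z[u]uv in G'. If H is
    nilpotent then u is nilpotent at v, and uv = 0 because a unipotent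
    automorphism of finite order of a torsion-free group is trivial. Otherwise
    H = N_G(H) contains v, so e = uv lies in u Z[u] e; since u^q is divisible
    by p on Z[u]e, so is Z[u]e, and Nakayama's lemma gives e = 0. Thus G acts
    trivially on V, and as G/G' is periodic, [g^n, h] = n [g, h] in V shows
    V = 0. So G'/G'' is periodic, whence so are the nilpotent group G' and G. *)

Set Implicit Arguments.
Unset Strict Implicit.
Unset Printing Implicit Defensive.
Import GRing.Theory.
Local Open Scope classical_set_scope.
Local Open Scope group_scope.

(** * Unipotent automorphisms of finite order *)

Definition torsion_free (V : zmodType) : Prop :=
  forall (v : V) n, (0 < n)%N -> (v *+ n = 0 -> v = 0)%R.

Section UnipotentAction.
Local Open Scope ring_scope.
Variables (V : zmodType) (u : {additive V -> V}).
Hypothesis tfV : torsion_free V.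

Lemma iter_unipotent_binomial q v :
  iter q (fun w => w + u w) v = \sum_(i < q.+1) iter i u v *+ 'C(q, i).
Proof.
elim: q => [|q IHq]; first by rewrite big_ord1 bin0 mulr1n.
rewrite iterS IHq raddf_sum big_ord_recl /= bin0 mulr1n.
rewrite [RHS]big_ord_recl bin0 mulr1n /= -addrA; congr (_ + _).
rewrite [RHS](eq_bigr (fun i : 'I_q.+1 =>
  iter i.+1 u v *+ 'C(q, i.+1) + iter i.+1 u v *+ 'C(q, i))); last first.
  by move=> i _; rewrite /bump /= add1n binS mulrnDr.
rewrite big_split /= [in RHS]big_ord_recr /= bin_small // mulr0n addr0.
by congr (_ + _); apply: eq_bigr => i _; rewrite raddfMn.
Qed.

(** If [u (u w) = 0], then (1 + u)^m w = w + m u w, so m u w = 0 and torsion-freeness gives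
    [u w = 0]. This lowers the exponent [c] step by step to 1. *)
Lemma unipotent_torsion_trivial m c v : (0 < m)%N ->
  (forall w, iter m (fun w => w + u w) w = w) -> iter c u v = 0 -> u v = 0.
Proof.
move=> m_gt0 tau1.
have sqr0 w : u (u w) = 0 -> u w = 0.
  move=> uuw; apply: (tfV m_gt0).
  have step n : iter n (fun w => w + u w) w = w + u w *+ n.
    elim: n => [|n IHn]; first by rewrite mulr0n addr0.
    by rewrite iterS IHn raddfD raddfMn uuw mul0rn addr0 mulrSr addrA.
  by have := step m; rewrite tau1 => /eqP; rewrite -subr_eq0 opprD addNKr oppr_eq0 => /eqP.
elim: c => [|[|c] IHc] //=; first by move=> ->; rewrite raddf0.
by move/sqr0/IHc.
Qed.

(* Nakayama's lemma over the localisation of [int] at p, by eliminating one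
   generator at a time. *)
Lemma nakayama_elimination (p : nat) n (d : nat -> V) : prime p ->
  (forall i, (i < n)%N -> exists2 r : int, ~~ (p %| `|r|)%N &
     exists c : nat -> int, d i *~ r = (\sum_(j < n) d j *~ c j) *~ p) ->
  forall i, (i < n)%N -> d i = 0.
Proof.
move=> p_pr; elim: n => // n IHn dH.
have [r pr [c]] := dH n (ltnSn n).
rewrite big_ord_recr /=; set S := \sum_(i < n) _ => dn.
(* The term of [d n] on the right is moved to the left; its new coefficient is still prime to
   [p]. *)
pose r' : int := r - c n * p%:Z.
have pr' : ~~ (p %| `|r'|)%N.
  apply: contra pr => pr'.
  suff : (p%:Z %| r)%Z by [].
  rewrite -[r](subrK (c n * p%:Z)) rpredD ?dvdz_mull //.
have dn' : d n *~ r' = S *~ p.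
  by rewrite /r' mulrzBr dn mulrzDl -mulrzA addrK.
have dlt i : (i < n)%N -> d i = 0.
  apply: IHn => {}i ltin.
  have [s ps [c']] := dH i (ltnW ltin); rewrite big_ord_recr /= => di.
  (* Multiplying the relation for [d i] by [r'] turns its term in [d n] into a multiple of [S],
     which eliminates [d n]. *)
  exists (s * r'); first by rewrite abszM Euclid_dvdM // negb_or ps.
  exists (fun j => c' j * r' + c j * (p%:Z * c' n)).
  rewrite mulrzA di.
  under [in RHS]eq_bigr => j _ do rewrite mulrzDr mulrzA [_ *~ (c j * _)]mulrzA.
  rewrite big_split /= -!mulrz_suml -/S !mulrzDl -!mulrzA.
  rewrite [(c' n * _)](_ : _ = r' * (c' n * p)); last by ring.
  rewrite [d n *~ _]mulrzA dn' -!mulrzA.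
  by congr (_ *~ _ + _ *~ _); ring.
move=> i; rewrite ltnS leq_eqVlt => /predU1P[-> | /dlt //].
have S0 : S = 0 by apply: big1 => j _; rewrite dlt ?mul0rz.
move: dn'; rewrite S0 mul0rz => dn0.
apply: (@tfV _ `|r'|%N).
  by rewrite lt0n; apply: contraNneq pr' => ->; rewrite dvdn0.
by case: r' {pr'} dn0 => m //= /eqP; rewrite oppr_eq0 => /eqP.
Qed.

(** With q = p^k, i C(q, i) = q C(q - 1, i - 1); if [p] did not divide C(q, i), then q would divide
    i < q. *)
Lemma dvdn_bin_prime_power p k i : prime p -> (0 < i < p ^ k)%N ->
  (p %| 'C(p ^ k, i))%N.
Proof.
move=> p_pr /andP[i_gt0 lt_i]; apply: contraT => npC.
have : (p ^ k %| i * 'C(p ^ k, i))%N.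
  case: i i_gt0 {lt_i npC} => // i _.
  have pk_gt0 : (0 < p ^ k)%N by rewrite expn_gt0 prime_gt0.
  by rewrite -{2}(prednK pk_gt0) -mul_bin_diag prednK // dvdn_mulr.
rewrite Gauss_dvdl; last by rewrite coprimeXl // prime_coprime.
by move/(dvdn_leq i_gt0); rewrite leqNgt lt_i.
Qed.

(** The hypothesis puts e in u Z[u]e, so Z[u]e = u Z[u]e = u^q Z[u]e, which lies in p Z[u]e.
    Nakayama's lemma applies to the generators u^i e, i < q. *)
Lemma unipotent_generator_trivial p k n (c : nat -> int) e : prime p ->
  (forall w, iter (p ^ k) (fun w => w + u w) w = w) ->
  e = \sum_(i < n) iter i.+1 u e *~ c i -> e = 0.
Proof.
move=> p_pr tau1 eE.
set q := (p ^ k)%N in tau1; have q_gt0 : (0 < q)%N by rewrite expn_gt0 prime_gt0.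
(* The elimination needs finitely many generators; [Dq] and [Du] will show that this span is all of
   Z[u]e. *)
pose D v := exists c : nat -> int, v = \sum_(i < q) iter i u e *~ c i.
have D0 : D 0 by exists (fun=> 0); rewrite big1 // => i _; rewrite mulr0z.
have DD v w : D v -> D w -> D (v + w).
  move=> [a ->] [b ->]; exists (fun i => a i + b i).
  by rewrite -big_split; apply: eq_bigr => i _; rewrite mulrzDr.
have DZ v (m : int) : D v -> D (v *~ m).
  move=> [a ->]; exists (fun i => a i * m).
  by rewrite mulrz_suml; apply: eq_bigr => i _; rewrite mulrzA.
have Dsum m (F : 'I_m -> V) : (forall i, D (F i)) -> D (\sum_i F i).
  by move=> DF; elim/big_ind: _.
have De i : (i < q)%N -> D (iter i u e).
  move=> ltiq; exists (fun j => (j == i)%:Z).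
  rewrite (bigD1 (Ordinal ltiq)) //= eqxx mulr1z big1 ?addr0 // => j.
  by rewrite -val_eqE /= => /negbTE ->; rewrite mulr0z.
have sumS (F : nat -> V) m : (0 < m)%N ->
    \sum_(i < m) F i = F 0%N + \sum_(i < m.-1) F i.+1.
  by case: m => // m _; rewrite big_ord_recl.
(* Expanding (1 + u)^q = 1 expresses u^q through the terms C(q, i) u^i with 0 < i < q, all divisible
   by [p]. *)
have uq w : iter q u w =
    (\sum_(i < q.-1) iter i.+1 u w *~ - ('C(q, i.+1) %/ p)%:Z) *~ p.
  have := tau1 w; rewrite iter_unipotent_binomial big_ord_recr /= binn mulr1n.
  rewrite (sumS (fun i => iter i u w *+ 'C(q, i))) //= bin0 mulr1n.
  rewrite -addrA => /eqP; rewrite -subr_eq0 addrAC subrr add0r addr_eq0 => /eqP SU.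
  rewrite -[LHS]opprK -SU.
  rewrite mulrz_suml -sumrN; apply: eq_bigr => i _.
  rewrite -mulrzA mulNr -PoszM divnK ?mulrNz //.
  by apply: dvdn_bin_prime_power; rewrite //= -/q -ltn_predRL.
have Dq : D (iter q u e).
  rewrite uq; apply/DZ/Dsum => i; apply/DZ/De.
  by rewrite -ltn_predRL.
have Du v : D v -> D (u v).
  move=> [a ->]; rewrite raddf_sum; apply: Dsum => i; rewrite raddfMz.
  apply: DZ; rewrite -iterS.
  by have := ltn_ord i; rewrite leq_eqVlt => /predU1P[-> | /De].
have Diter i v : D v -> D (iter i u v) by elim: i => //= i IHi /IHi /Du.
(* A preimage of [e] under [u] inside [D]; it makes [u] map [D] onto itself. *)
pose e1 := \sum_(i < n) iter i u e *~ c i.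
have ue1 : u e1 = e.
  by rewrite raddf_sum [RHS]eE; apply: eq_bigr => i _; rewrite raddfMz.
have De1 : D e1 by apply: Dsum => i; apply/DZ/Diter/(De 0%N).
have uD v : D v -> exists2 w, D w & v = u w.
  move=> [a ->]; exists (\sum_(i < q) iter i u e1 *~ a i).
    by apply: Dsum => i; apply/DZ/Diter.
  rewrite raddf_sum; apply: eq_bigr => i _.
  by rewrite raddfMz -iterS iterSr ue1.
have uiterD i v : D v -> exists2 w, D w & v = iter i u w.
  elim: i v => [|i IHi] v Dv; first by exists v.
  by have [w /uD[w' Dw' ->] ->] := IHi v Dv; exists w' => //; rewrite iterSr.
apply: (@nakayama_elimination p q (fun i => iter i u e)) q_gt0 => // i ltiq.
exists 1; first by rewrite dvdn1; apply: contraTneq p_pr => ->.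
have [w Dw ->] := uiterD q _ (De i ltiq); rewrite mulr1z uq.
have [a ->] : D (\sum_(i < q.-1) iter i.+1 u w *~ - ('C(q, i.+1) %/ p)%:Z).
  by apply: Dsum => j; apply/DZ/Diter.
by exists a.
Qed.

End UnipotentAction.

(** * Indecomposable abelian groups *)

Definition subzmod (V : zmodType) (P : set V) : Prop :=
  P 0%R /\ forall v w, P v -> P w -> P (v - w)%R.

Section AdditiveSubgroups.
Local Open Scope ring_scope.
Variable V : zmodType.
Implicit Types P Q : set V.

Lemma subzmodN P v : subzmod P -> P v -> P (- v).
Proof. by move=> [P0 PB] Pv; rewrite -sub0r; apply: PB. Qed.

Lemma subzmodD P v w : subzmod P -> P v -> P w -> P (v + w).
Proof.
by move=> sP Pv Pw; rewrite -[w]opprK; apply: sP.2 => //; apply: subzmodN.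
Qed.

Lemma subzmodMz P v (n : int) : subzmod P -> P v -> P (v *~ n).
Proof.
move=> sP Pv; have PMn m : P (v *+ m).
  elim: m => [|m IHm]; first by rewrite mulr0n; apply: sP.1.
  by rewrite mulrS; apply: subzmodD.
case: n => n; first by rewrite -pmulrn; apply: PMn.
by rewrite NegzE mulrNz -pmulrn; apply: subzmodN; last exact: PMn.
Qed.

Lemma bezout_split P Q v (m n : nat) : subzmod P -> subzmod Q ->
  coprime m n -> P (v *+ m) -> Q (v *+ n) -> exists a b, [/\ P a, Q b & v = a + b].
Proof.
move=> sP sQ co Pv Qv.
have [a [b abE]] : exists a b : int, a * m%:Z + b * n%:Z = 1.
  have [a [b e]] := Bezoutz m n; exists a, b; rewrite e /gcdz /=.
  by rewrite (eqP co).
exists (v *+ m *~ a), (v *+ n *~ b); split; [exact: subzmodMz..|].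
rewrite !pmulrn -!mulrzA -mulrzDr.
by rewrite [_ * a]mulrC [_ * b]mulrC abE mulr1z.
Qed.

(** Zorn's lemma gives [B]. By maximality, B + Zy contains a positive multiple of [x] whenever [y]
    is outside [B], so V/B has rank one. *)
Lemma maximal_avoiding x : (forall n, (0 < n)%N -> x *+ n != 0) ->
  exists2 B : set V, subzmod B & (forall n, (0 < n)%N -> ~ B (x *+ n)) /\
    forall y, exists (n : nat) (j : int), (0 < n)%N /\ B (y *+ n - x *~ j).
Proof.
move=> xinf; pose avoids (B : set V) := forall n, (0 < n)%N -> ~ B (x *+ n).
have [|B [[B0 Bx] Bmax]] :=
    @Zorn_bigcup V [set B : set V | (B = set0 \/ subzmod B) /\ avoids B].
  move=> F FP Ftot; split; last by move=> n n0 [B /FP[_ +]]; apply.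
  have [[B FB sB]|noB] := pselect (exists2 B, F B & subzmod (B : set V)); last first.
    left; apply/seteqP; split => // v [C FC Cv]; have [[C0|sC] _] := FP C FC.
      by rewrite C0 in Cv.
    by case: noB; exists C.
  right; split; first by exists B => //; apply: sB.1.
  move=> v w [C FC Cv] [D FD Dw].
  have sub E z : F E -> E z -> subzmod E.
    by move=> FE Ez; case: (FP E FE) => -[E0|//] _; rewrite E0 in Ez.
  have [CD|DC] := Ftot C D FC FD.
    by exists D => //; apply: (sub D w FD Dw).2 => //; apply: CD.
  by exists C => //; apply: (sub C v FC Cv).2 => //; apply: DC.
have sB : subzmod B.
  case: B0 => // B0; exfalso; apply: (Bmax [set 0]).
    by rewrite B0; split=> // /(_ 0 erefl).
  split; last by move=> n n0 /eqP; apply/negP/xinf.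
  by right; split=> // v w -> ->; rewrite subr0.
exists B => //; split=> // y.
have [By|nBy] := pselect (B y).
  by exists 1%N, 0; split=> //; rewrite mulr0z subr0.
pose C : set V := [set z | exists2 b, B b & exists k : int, z = b + y *~ k].
have sC : subzmod C.
  split; first by exists 0; [apply: sB.1 | exists 0; rewrite mulr0z addr0].
  move=> _ _ [b Bb [k ->]] [b' Bb' [k' ->]].
  exists (b - b'); first exact: sB.2.
  by exists (k - k'); rewrite mulrzBr opprD addrACA.
have BC : B `<=` C by move=> b Bb; exists b => //; exists 0; rewrite mulr0z addr0.
have : ~ avoids C.
  move=> aC; apply: (Bmax C); last by split=> //; right.
  split=> // CB; apply/nBy/CB.
  by exists 0; [apply: sB.1 | exists 1; rewrite add0r mulr1z].
move=> /existsNP[n /not_implyP[n0 /contrapT[b Bb [k xnE]]]].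
have bE : b = x *+ n - y *~ k by rewrite xnE addrK.
(* [k = 0] would put [x *+ n] in [B]; a negative [k] is handled by changing the sign of the
   coefficient of [x]. *)
case: k => k in xnE bE.
  case: k => [|k] in xnE bE.
    by case: (Bx n n0); rewrite xnE mulr0z addr0.
  exists k.+1, n%:Z; split=> //.
  by rewrite -opprB; apply: subzmodN; rewrite // -bE.
exists k.+1, (- n%:Z); split=> //.
by move: bE; rewrite NegzE !mulrNz !opprK -pmulrn addrC => <-.
Qed.

Lemma periodic_of_indecomposable :
  (forall P Q : set V, subzmod P -> subzmod Q ->
     (forall v, exists a b, [/\ P a, Q b & v = a + b]) ->
     (forall v, P v) \/ (forall v, Q v)) ->
  forall v : V, exists2 n, (0 < n)%N & v *+ n = 0.
Proof.
move=> indec x; apply: contrapT => xper.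
have xinf n : (0 < n)%N -> x *+ n != 0.
  by move=> n0; apply/eqP => xn; apply: xper; exists n.
have [B sB [Bx Bess]] := maximal_avoiding xinf.
(* V/B embeds into the rationals with x sent to 1, and P p is the preimage of
   the rationals of positive p-adic valuation; P 2 and P 3 do not contain x,
   but they generate V. *)
pose P (p : nat) : set V := [set y | exists (n : nat) (j : int),
  coprime p n /\ B (y *+ n - x *~ (p%:Z * j))].
have sP p : subzmod (P p).
  split.
    exists 1%N, 0; rewrite mul0rn mulr0 mulr0z subr0.
    by split; [exact: coprimen1 | exact: sB.1].
  move=> v w [n [j [pn Bv]]] [n' [j' [pn' Bw]]].
  exists (n * n')%N, (j * n'%:Z - j' * n%:Z); rewrite coprimeMr pn pn'; split=> //.
  have -> : p%:Z * (j * n'%:Z - j' * n%:Z) = p%:Z * j * n' - p%:Z * j' * n by ring.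
  have -> : (v - w) *+ (n * n') - x *~ (p%:Z * j * n' - p%:Z * j' * n)
      = (v *+ n - x *~ (p%:Z * j)) *~ n' - (w *+ n' - x *~ (p%:Z * j')) *~ n.
    rewrite !pmulrn !mulrzBl mulrzBr -!mulrzA PoszM [n'%:Z * n%:Z]mulrC.
    by rewrite !opprB addrACA [LHS]addrC [- _ - _]addrC [LHS]addrC -addrACA.
  by apply: sB.2; apply: subzmodMz.
(* As [x] has infinite order modulo [B], a witness would satisfy n = p j, against coprimality. *)
have Px p : prime p -> ~ P p x.
  move=> p_pr [n [j [pn]]]; rewrite pmulrn -mulrzBr => Bxn.
  suff n0 : n%:Z - p%:Z * j = 0.
    move: pn; rewrite prime_coprime //; apply/negP; rewrite negbK.
    suff : (p%:Z %| n%:Z)%Z by [].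
    by rewrite (subr0_eq n0) dvdz_mulr.
  case: (n%:Z - p%:Z * j) Bxn => [[|m] //|m].
    by move/(Bx _ (ltn0Sn m)).
  by move/(subzmodN sB); rewrite NegzE mulrNz opprK; move/(Bx _ (ltn0Sn m)).
(* Multiplying j/n by p times the p-part of n clears that part of the denominator and leaves a
   factor p in the numerator. *)
have Pin p y n (j : int) : prime p -> (0 < n)%N -> B (y *+ n - x *~ j) ->
    P p (y *+ (p ^ (logn p n).+1)).
  move=> p_pr n0 By; exists (n`_p^')%N, j; split.
    by rewrite prime_coprime // -p'natE // part_pnat.
  rewrite -mulrnA expnS -mulnA -p_part partnC // mulnC mulrnA mulrC mulrzA.
  by rewrite -pmulrn -mulrnBl pmulrn; apply: subzmodMz.
have [v|P2|P3] := indec (P 2) (P 3) (sP 2%N) (sP 3%N).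
- have [n [j [n0 By]]] := Bess v.
  by apply: bezout_split (Pin 2%N _ _ _ _ n0 By) (Pin 3%N _ _ _ _ n0 By) => //;
    rewrite coprimeXl ?coprimeXr.
- exact: (@Px 2%N).
- exact: (@Px 3%N).
Qed.

(** A periodic group is the sum of its p-part [P] and its p'-part [Q]. With p dividing the order n
    of [v0], the element (n/p) v0 has order p, so [Q] is proper. *)
Lemma primary_of_indecomposable : (exists v : V, v != 0) ->
  (forall P Q : set V, subzmod P -> subzmod Q ->
     (forall v, exists a b, [/\ P a, Q b & v = a + b]) ->
     (forall v, P v) \/ (forall v, Q v)) ->
  exists2 p, prime p & forall v : V, exists k, v *+ p ^ k = 0.
Proof.
move=> [v0 v0_neq0] indec; have per := periodic_of_indecomposable indec.
have [n /andP[n_gt0 /eqP v0n] n_min] :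
    {n | (0 < n)%N && (v0 *+ n == 0) &
         forall m, (0 < m)%N && (v0 *+ m == 0) -> (n <= m)%N}.
  have ex : exists n, (0 < n)%N && (v0 *+ n == 0).
    by have [n n0 vn] := per v0; exists n; rewrite n0 vn /=.
  by exists (ex_minn ex); case: ex_minnP.
have n_gt1 : (1 < n)%N.
  rewrite ltn_neqAle n_gt0 andbT; apply: contraNneq v0_neq0 => n1.
  by rewrite -n1 mulr1n in v0n; rewrite v0n.
pose p := pdiv n; have p_pr : prime p := pdiv_prime n_gt1.
have pn : (p %| n)%N := pdiv_dvd n.
exists p => //.
pose P : set V := [set v | exists k, v *+ p ^ k = 0].
pose Q : set V := [set v | exists2 m, coprime p m & v *+ m = 0].
have sP : subzmod P.
  split=> [|v w [k vk] [l wl]]; first by exists 0%N; rewrite mul0rn.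
  exists (k + l)%N; rewrite mulrnBl expnD mulrnA vk mul0rn mulnC mulrnA wl.
  by rewrite mul0rn subr0.
have sQ : subzmod Q.
  split=> [|v w [k pk vk] [l pl wl]].
    by exists 1%N; rewrite ?coprimen1 ?mul0rn.
  exists (k * l)%N; first by rewrite coprimeMr pk.
  by rewrite mulrnBl mulrnA vk mul0rn mulnC mulrnA wl mul0rn subr0.
have [v|//|Qall] := indec P Q sP sQ.
  have [m m_gt0 vm] := per v.
  have co : coprime m`_p^' m`_p by rewrite coprime_sym coprime_partC.
  apply: (bezout_split sP sQ co).
    by exists (logn p m); rewrite -mulrnA -p_part mulnC partnC.
  exists (m`_p^')%N; last by rewrite -mulrnA partnC.
  by rewrite prime_coprime // -p'natE // part_pnat.
have [m pm] := Qall (v0 *+ (n %/ p)).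
move=> vm; exfalso.
have : (n <= n %/ p)%N.
  apply: n_min; rewrite divn_gt0 ?prime_gt0 // dvdn_leq //=.
  rewrite -[_ *+ _]mulr1n; apply/eqP.
  (* An element killed by both [m] and [p] is zero: this is the Bezout splitting with two trivial
     subgroups. *)
  suff [a [b [a0 b0 ->]]] : exists a b, [/\ [set 0] a, [set 0] b & v0 *+ (n %/ p) *+ 1 = a + b].
    by rewrite a0 b0 addr0.
  rewrite mulr1n; apply: bezout_split pm _ vm.
  - by split=> // v w -> ->; rewrite subr0.
  - by split=> // v w -> ->; rewrite subr0.
  - by rewrite /= -mulrnA divnK.
by rewrite leqNgt ltn_Pdiv ?prime_gt1.
Qed.

End AdditiveSubgroups.

(** * Subgroups, central series and Fitting's theorem *)

Section Subgroups.
Variable G : groupType.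
Implicit Types (A B C H K M N : set G) (g h x y : G).

Definition normal_set N : Prop := forall x g, N x -> N (x ^ g).

Lemma commMgJ_group x y z : [~ x * y, z] = [~ x, z] ^ y * [~ y, z].
Proof.
by rewrite /commg /conjg !invgM -!mulgA !mulVKg.
Qed.

Lemma commgMJ_group x y z : [~ x, y * z] = [~ x, z] * [~ x, y] ^ z.
Proof. by rewrite -[LHS]invgK invgR commMgJ_group invgM -conjVg !invgR. Qed.

Lemma commVgJ_group x y : [~ x^-1, y] = ([~ x, y] ^ x^-1)^-1.
Proof.
by apply/esym/mulg1_eq; rewrite -(commMgJ_group x x^-1) mulgV comm1g.
Qed.

Lemma subgroupP H :
  subgroup H <-> H 1 /\ forall x y, H x -> H y -> H (x / y).
Proof.
split=> [[H1 HB]|[H1 HB]].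
  split=> [|x y Hx Hy]; first by rewrite inE in H1.
  by rewrite -in_setE; apply: HB; rewrite inE.
by split=> [|x y]; rewrite ?inE // => Hx Hy; apply: HB.
Qed.

Lemma subgroup1 H : subgroup H -> H 1.
Proof. by case/subgroupP. Qed.

Lemma subgroupV H x : subgroup H -> H x -> H x^-1.
Proof. by case/subgroupP=> H1 HB Hx; rewrite -[x^-1]mul1g; apply: HB. Qed.

Lemma subgroupM H x y : subgroup H -> H x -> H y -> H (x * y).
Proof.
move=> sH Hx Hy; have /subgroupP[_ HB] := sH.
by rewrite -[y]invgK; apply: HB => //; apply: subgroupV.
Qed.

Lemma subgroupX H x n : subgroup H -> H x -> H (x ^+ n).
Proof.
move=> sH Hx; elim: n => [|n IHn]; first exact: subgroup1.
by rewrite expgS; apply: subgroupM.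
Qed.

Lemma subgroupT : subgroup [set: G].
Proof. by apply/subgroupP; split=> [|x y _ _]; apply: I. Qed.

Lemma subgroup_trivial : subgroup [set 1 : G].
Proof. by apply/subgroupP; split=> // _ _ -> ->; rewrite /= divg1. Qed.

Lemma generated_subgroup A : subgroup (generated A).
Proof.
apply/subgroupP; split=> [C [sC _]|x y Ax Ay C CA]; first exact: subgroup1.
by have /subgroupP[_] := CA.1; apply; [apply: Ax|apply: Ay].
Qed.

(** The elements whose conjugate by [g] lies in [generated A] form a subgroup containing [A]. *)
Lemma generated_normal A : normal_set A -> normal_set (generated A).
Proof.
move=> nA x g Ax; pose C : set G := [set y | generated A (y ^ g)].
suff : C x by [].
apply: Ax; split=> [|y Ay]; last by move=> D [_]; apply; apply: nA.
have sA := generated_subgroup A.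
apply/subgroupP; rewrite /C /= conj1g; split=> [|y z Ay Az]; first exact: subgroup1.
by rewrite conjMg conjVg; apply: (subgroupM sA) => //; apply: (subgroupV sA).
Qed.

Lemma commutator_subgroup_subgroup A B : subgroup (commutator_subgroup A B).
Proof. exact: generated_subgroup. Qed.

Lemma mem_commutator A B x y :
  A x -> B y -> commutator_subgroup A B [~ x, y].
Proof. by move=> Ax By; move=> C [_]; apply; exists x => //; exists y. Qed.

Lemma commutator_subset A B C : subgroup C ->
  (forall x y, A x -> B y -> C [~ x, y]) -> commutator_subgroup A B `<=` C.
Proof.
by move=> sC AB; apply: smallest_sub => // _ [x Ax [y By <-]]; apply: AB.
Qed.

Lemma commutator_mono A B A' B' : A `<=` A' -> B `<=` B' ->
  commutator_subgroup A B `<=` commutator_subgroup A' B'.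
Proof.
move=> AA BB; apply: commutator_subset.
  exact: commutator_subgroup_subgroup.
by move=> x y /AA Ax /BB By; apply: mem_commutator.
Qed.

Lemma commutator_normal A B : normal_set A -> normal_set B ->
  normal_set (commutator_subgroup A B).
Proof.
move=> nA nB; apply: generated_normal => _ g [x Ax [y By <-]].
by exists (x ^ g); [apply: nA|exists (y ^ g); [apply: nB|rewrite conjRg]].
Qed.

Lemma commutator_subl N A : subgroup N -> normal_set N ->
  commutator_subgroup N A `<=` N.
Proof.
move=> sN nN; apply: commutator_subset => // x y Nx _.
by rewrite commgEl; apply: subgroupM; [|apply: subgroupV|apply: nN].
Qed.

Lemma lcs_subgroup H n : subgroup H -> subgroup (lower_central_series H n).
Proof. by case: n => // n _; apply: commutator_subgroup_subgroup. Qed.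

Lemma lcs_normal N n : normal_set N -> normal_set (lower_central_series N n).
Proof. by move=> nN; elim: n => //= n IHn; apply: commutator_normal. Qed.

Lemma lcsS_sub N n : subgroup N -> normal_set N ->
  lower_central_series N n.+1 `<=` lower_central_series N n.
Proof.
by move=> sN nN; apply: commutator_subl; [apply: lcs_subgroup|apply: lcs_normal].
Qed.

Lemma nilpotent_subset H K : subgroup H -> H `<=` K ->
  nilpotent_subgroup K -> nilpotent_subgroup H.
Proof.
move=> sH HK [n Kn]; exists n; apply/seteqP; split=> [x|_ ->]; last first.
  by apply: subgroup1; apply: lcs_subgroup.
suff sub m : lower_central_series H m `<=` lower_central_series K m.
  by move/sub; rewrite Kn.
by elim: m => //= m IHm; apply: commutator_mono.
Qed.

Lemma normalizer_mem H g : (forall h, H h -> H (h ^ g)) ->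
  (forall h, H h -> H (h ^ g^-1)) -> normalizer H g.
Proof.
move=> Hg HVg; apply/seteqP; split=> [_ [h Hh <-]|h Hh]; first exact: Hg.
by exists (h ^ g^-1); [apply: HVg|rewrite conjgKV].
Qed.

Lemma normalizer_normal N : normal_set N -> normalizer N = [set: G].
Proof.
by move=> nN; apply/seteqP; split=> // g _; apply: normalizer_mem => h; apply: nN.
Qed.

Fixpoint upper_central n : set G :=
  if n is m.+1 then [set g | forall h, upper_central m [~ g, h]] else [set 1].

Lemma upper_central_normal n :
  subgroup (upper_central n) /\ normal_set (upper_central n).
Proof.
elim: n => [|n [sZ nZ]] /=.
  by split; [exact: subgroup_trivial|move=> _ g ->; rewrite /= conj1g].
have Zconj h x : upper_central n.+1 x -> upper_central n.+1 (x ^ h).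
  by move=> Zx g; rewrite -[g](conjgKV h) -conjRg; apply/nZ/Zx.
split; last by move=> x g; apply: Zconj.
apply/subgroupP; split=> [h|x y Zx Zy h]; first by rewrite comm1g; apply: subgroup1.
rewrite commMgJ_group; apply: subgroupM => //; first exact/nZ/Zx.
by rewrite commVgJ_group; apply: subgroupV => //; apply: nZ; apply: Zy.
Qed.

Lemma upper_centralS n : upper_central n `<=` upper_central n.+1.
Proof.
move=> g Zg h; have [sZ nZ] := upper_central_normal n.
by rewrite commgEl; apply: subgroupM; [|apply: subgroupV|apply: nZ].
Qed.

Lemma upper_central_add n m : upper_central n `<=` upper_central (n + m).
Proof.
elim: m => [|m IHm]; first by rewrite addn0.
by rewrite addnS => g /IHm; apply: upper_centralS.
Qed.

Lemma nilpotent_of_upper_central n :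
  (forall g, upper_central n g) -> nilpotent_group G.
Proof.
move=> Zn; exists n; apply/seteqP; split=> [x|_ ->]; last first.
  by apply: subgroup1; apply: lcs_subgroup; apply: subgroupT.
suff sub m : (m <= n)%N ->
    lower_central_series [set: G] m `<=` upper_central (n - m).
  by move/(sub n (leqnn n)); rewrite subnn.
elim: m => [_ g _|m IHm lt_mn]; first by rewrite subn0.
apply: commutator_subset; first by case: (upper_central_normal (n - m.+1)).
move=> y h /(IHm (ltnW lt_mn)); rewrite -subSS subSn // => + _; exact.
Qed.

(* Fitting's theorem; the last hypothesis spares the computation of the lower
   central series of the quotient by M. *)
Lemma nilpotent_product M K :
    subgroup M -> normal_set M -> nilpotent_subgroup M ->
    subgroup K -> normal_set K -> nilpotent_subgroup K ->
    (forall g, exists m k, [/\ M m, K k & g = m * k]) ->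
    (forall g h, M [~ g, h]) ->
  nilpotent_group G.
Proof.
move=> sM nM [c Mc] sK nK [d Kd] GMK GM.
suff [n Mn] : exists n, M `<=` upper_central n.
  by apply: (@nilpotent_of_upper_central n.+1) => g h; apply/Mn/GM.
(* Induction up the lower central series of [M], from its trivial term to [M] itself. *)
suff descend i : (i <= c)%N ->
    exists n, lower_central_series M (c - i) `<=` upper_central n.
  by have := descend c (leqnn c); rewrite subnn.
elim: i => [_|i IHi lt_ic]; first by exists 0%N; rewrite subn0 Mc.
have [n Zn] := IHi (ltnW lt_ic); exists (n + d.+1)%N.
rewrite -subSS subSn // in Zn; set s := (c - i.+1)%N in Zn *.
have sMs : subgroup (lower_central_series M s) by apply: lcs_subgroup.
have nMs : normal_set (lower_central_series M s) by apply: lcs_normal.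
(* This is [Ms, K, ..., K] with [j] entries K, where Ms is the term of index [s]. It lies in Ms and,
   with a shift of one, in the series of [K]; so [X d.+1] is trivial. *)
pose X j := iter j (fun A => commutator_subgroup A K) (lower_central_series M s).
have sX j : subgroup (X j) by case: j => // j; apply: commutator_subgroup_subgroup.
have nX j : normal_set (X j) by elim: j => //= j IHj; apply: commutator_normal.
have XMs j : X j `<=` lower_central_series M s.
  elim: j => //= j IHj x Xx; apply: IHj; exact: commutator_subl Xx.
have XK j : X j.+1 `<=` lower_central_series K j.
  elim: j => [|j IHj]; last exact: commutator_mono.
  apply: commutator_subset => // x y _ Ky.
  by rewrite commgEr; apply: subgroupM => //; apply: nK; apply: subgroupV.
suff XZ j t : (t + j = d.+1)%N -> X t `<=` upper_central (n + j).
  exact: (XZ _ 0%N).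
elim: j t => [|j IHj] t.
  rewrite addn0 => -> x /XK; rewrite Kd => ->; apply: subgroup1.
  by case: (upper_central_normal (n + 0)).
rewrite -addSnnS => td x Xx; rewrite addnS => g.
(* [x, m k] = [x, k] [x, m]^k: the first factor lies in the next [X], the second comes from the next
   term of the series of [M], already in [upper_central n]. *)
have [m [k [Mm Kk ->]]] := GMK g.
have [sZ nZ] := upper_central_normal (n + j).
rewrite commgMJ_group; apply: subgroupM => //.
  by apply: (IHj t.+1) => //; apply: mem_commutator.
apply: nZ; apply: upper_central_add; apply: Zn.
by apply: mem_commutator => //; apply: XMs Xx.
Qed.

End Subgroups.

(** * Abelian sections as additive groups *)

(** [V] is an additive copy of [N] modulo its intersection with [I]. Making [f] total on [G],
    unconstrained outside [N], avoids turning [N] into a type. *)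
Record section_map (G : groupType) (N I : set G) (V : zmodType) (f : G -> V) :
    Prop := SectionMap {
  section_mapM : forall a b, N a -> N b -> f (a * b) = (f a + f b)%R;
  section_map_eq0 : forall a, N a -> f a = 0%R <-> I a;
  section_map_surj : forall v, exists2 a, N a & f a = v }.

Section AbelianSection.
Local Open Scope quotient_scope.
Variables (G : groupType) (N I : set G).
Hypotheses (sN : subgroup N) (sI : subgroup I).
Hypothesis NI : forall a b, N a -> N b -> I [~ a, b].

Definition section_base := {x : G | `[< N x >]}.

Definition section_rel (x y : section_base) : bool :=
  `[< I (sval x / sval y) >].

Lemma section_rel_equiv : equiv_class_of section_rel.
Proof.
split=> [x|x y|y x z]; rewrite /section_rel.
- by apply/asboolP; rewrite mulgV; apply: subgroup1.
- by apply/asboolP/asboolP => /(subgroupV sI); rewrite invgF.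
- move=> /asboolP xy /asboolP yz; apply/asboolP.
  by rewrite -(divgKA (sval y)); apply: subgroupM => //.
Qed.

Canonical section_equiv := EquivRelPack section_rel_equiv.

Definition section_quotient := {eq_quot section_equiv}.
HB.instance Definition _ := Choice.on section_quotient.

Definition section_in x (Nx : N x) : section_base := exist _ x (asboolT Nx).
Definition section_pi x (Nx : N x) : section_quotient := \pi_{eq_quot section_equiv} (section_in Nx).

Lemma section_pi_eq x y (Nx : N x) (Ny : N y) :
  section_pi Nx = section_pi Ny <-> I (x / y).
Proof.
split=> [/eqquotP /asboolP //|Ixy]; by apply/eqquotP/asboolP.
Qed.

Lemma section_pi_surj (v : section_quotient) :
  exists x (Nx : N x), v = section_pi Nx.
Proof.
have := reprK v; case: (repr v) => x Nx <-; exists x, (asboolW Nx).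
by congr (\pi_{eq_quot section_equiv} _); apply: val_inj.
Qed.


Definition section_rep (v : section_quotient) : G := sval (repr v).

Lemma section_repN v : N (section_rep v).
Proof. by rewrite /section_rep; case: (repr v) => x /= /asboolP. Qed.

Lemma section_repK v (Nx : N (section_rep v)) : section_pi Nx = v.
Proof.
rewrite -[RHS]reprK; congr (\pi_{eq_quot section_equiv} _); exact: val_inj.
Qed.

Lemma section_rep_pi x (Nx : N x) : I (section_rep (section_pi Nx) / x).
Proof. by rewrite -(section_pi_eq (section_repN _)) section_repK. Qed.

Definition section_add v w :=
  section_pi (subgroupM sN (section_repN v) (section_repN w)).
Definition section_opp v := section_pi (subgroupV sN (section_repN v)).
Definition section_zero := section_pi (subgroup1 sN).

Lemma section_pi_proof_irrelevance x y (Nx : N x) (Ny : N y) :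
  x = y -> section_pi Nx = section_pi Ny.
Proof. by move=> xy; apply/section_pi_eq; rewrite xy mulgV; apply: subgroup1. Qed.

Lemma section_conj a b : N a -> N b -> I a -> I (a ^ b).
Proof.
move=> Na Nb Ia; rewrite -[a ^ b](mulVKg a) -commgEl.
by apply: subgroupM => //; apply: NI.
Qed.

Lemma section_add_pi x y (Nx : N x) (Ny : N y) :
  section_add (section_pi Nx) (section_pi Ny) = section_pi (subgroupM sN Nx Ny).
Proof.
apply/section_pi_eq; set x' := section_rep _; set y' := section_rep _.
(* Both factors lie in [I], the second because [I] contains the commutators of [N] and so is stable
   under conjugation by [N]. *)
have -> : x' * y' / (x * y) = (x' / x) * (y' / y) ^ x^-1.
  by rewrite /conjg invgK invgM !mulgA mulgVK.
apply: subgroupM => //; first exact: section_rep_pi.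
apply: section_conj; last exact: section_rep_pi.
- by apply: subgroupM => //; [apply: section_repN|apply: subgroupV].
- exact: subgroupV.
Qed.

Lemma section_addA : associative section_add.
Proof.
move=> u v w.
have [x [Nx ->]] := section_pi_surj u; have [y [Ny ->]] := section_pi_surj v.
have [z [Nz ->]] := section_pi_surj w; rewrite !section_add_pi.
exact/section_pi_proof_irrelevance/mulgA.
Qed.

Lemma section_addC : commutative section_add.
Proof.
move=> u v; have [x [Nx ->]] := section_pi_surj u.
have [y [Ny ->]] := section_pi_surj v; rewrite !section_add_pi.
apply/section_pi_eq.
have -> : x * y / (y * x) = [~ x^-1, y^-1].
  by rewrite /commg /conjg !invgK invgM !mulgA.
by apply: NI; apply: subgroupV.
Qed.

Lemma section_add0 : left_id section_zero section_add.
Proof.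
move=> u; have [x [Nx ->]] := section_pi_surj u; rewrite section_add_pi.
exact/section_pi_proof_irrelevance/mul1g.
Qed.

Lemma section_addN : left_inverse section_zero section_opp section_add.
Proof.
move=> u; rewrite /section_opp -[X in section_add _ X](section_repK (section_repN u)).
rewrite section_add_pi; exact/section_pi_proof_irrelevance/mulVg.
Qed.

End AbelianSection.

Lemma abelian_section (G : groupType) (N I : set G) :
    subgroup N -> subgroup I -> (forall a b, N a -> N b -> I [~ a, b]) ->
  exists (V : zmodType) (f : G -> V), section_map N I f.
Proof.
move=> sN sI NI.
pose f g : section_quotient N sI :=
  if pselect (N g) is left Ng then section_pi sI Ng else section_zero sN sI.
have fE g (Ng : N g) : f g = section_pi sI Ng.
  by rewrite /f; case: pselect => // Ng'; apply: section_pi_proof_irrelevance.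
pose V : zmodType := HB.pack (section_quotient N sI)
  (GRing.isZmodule.Build (section_quotient N sI)
     (@section_addA G N I sN sI NI) (@section_addC G N I sN sI NI)
     (@section_add0 G N I sN sI NI) (@section_addN G N I sN sI NI)).
exists V, f; split=> [a b Na Nb|a Na|v].
- rewrite (fE _ Na) (fE _ Nb) (fE _ (subgroupM sN Na Nb)).
  exact: esym (@section_add_pi G N I sN sI NI _ _ Na Nb).
- rewrite (fE _ Na) -[X in I X]divg1.
  exact: (@section_pi_eq G N I sI _ _ Na (subgroup1 sN)).
- by have [x [Nx ->]] := section_pi_surj v; exists x; rewrite ?(fE _ Nx).
Qed.

Section SectionMap.
Variables (G : groupType) (N I : set G) (V : zmodType) (f : G -> V).
Hypotheses (sN : subgroup N) (fP : section_map N I f).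

Lemma section_map1 : f 1 = 0%R.
Proof.
have N1 := subgroup1 sN.
by apply: (@addrI _ (f 1)); rewrite -(section_mapM fP) // mulg1 addr0.
Qed.

Lemma section_mapV a : N a -> f a^-1 = (- f a)%R.
Proof.
move=> Na; apply: (@addrI _ (f a)); rewrite -(section_mapM fP) //.
  by rewrite mulgV section_map1 subrr.
exact: subgroupV.
Qed.

Lemma section_mapX a n : N a -> f (a ^+ n) = (f a *+ n)%R.
Proof.
move=> Na; elim: n => [|n IHn]; first by rewrite section_map1.
by rewrite expgS (section_mapM fP) ?IHn ?mulrS //; apply: subgroupX.
Qed.

Lemma section_map_eq a b : N a -> N b -> f a = f b <-> I (a / b).
Proof.
move=> Na Nb; have NVb := subgroupV sN Nb.
rewrite -(section_map_eq0 fP) ?(section_mapM fP) ?section_mapV //; last exact: subgroupM.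
by split=> [->|/subr0_eq]; rewrite ?subrr.
Qed.

Lemma section_mapJ a b : N a -> N b -> f (a ^ b) = f a.
Proof.
move=> Na Nb; have NVb := subgroupV sN Nb; have Nab := subgroupM sN Na Nb.
by rewrite conjgE !(section_mapM fP) // section_mapV // addrC addrK.
Qed.

Lemma section_torsion_subgroup :
  subgroup [set a | N a /\ exists2 n, (0 < n)%N & (f a *+ n = 0)%R].
Proof.
apply/subgroupP; split=> [|a b [Na [m m0 am]] [Nb [n n0 bn]]].
  by split; [exact: subgroup1|exists 1%N; rewrite // section_map1].
have NVb := subgroupV sN Nb; split; first exact: subgroupM.
exists (m * n)%N; first by rewrite muln_gt0 m0.
rewrite (section_mapM fP) // section_mapV // mulrnBl mulrnA am mul0rn.
by rewrite mulnC mulrnA bn mul0rn subr0.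
Qed.

(** [a^(n+1), h] = [a^n, h]^a [a, h], and [f] does not see the conjugation by [a]. *)
Lemma section_map_commX a h n :
    (forall c, N c -> N (c ^ a) /\ f (c ^ a) = f c) -> N [~ a, h] ->
  N [~ a ^+ n, h] /\ f [~ a ^+ n, h] = (f [~ a, h] *+ n)%R.
Proof.
move=> fa Nah; elim: n => [|n [Nn fn]].
  by rewrite expg0 comm1g section_map1; split=> //; apply: subgroup1.
rewrite expgSr commMgJ_group; have [Na fna] := fa _ Nn.
by split; [exact: subgroupM|rewrite (section_mapM fP) // fna fn mulrSr].
Qed.

(** Conjugation by [x] preserves [N] and [I], so it induces a map t on [V], computed on chosen
    preimages; [u] is t - 1. *)
Lemma section_map_normal_action x :
    normal_set N -> normal_set I ->
  exists u : {additive V -> V}, forall a, N a -> f (a ^ x) = (f a + u (f a))%R.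
Proof.
move=> nN nI.
have /boolp.choice[s sP] : forall v, exists a, N a /\ f a = v.
  by move=> v; have [a Na <-] := section_map_surj fP v; exists a.
pose t v := f (s v ^ x).
have tf a : N a -> t (f a) = f (a ^ x).
  move=> Na; have [Ns fs] := sP (f a).
  apply/section_map_eq; rewrite ?conjMg -?conjVg -?conjMg; [exact: nN..|].
  by apply: nI; apply/section_map_eq.
pose u v := (t v - v)%R.
have uD : zmod_morphism u.
  move=> v w; have [a Na <-] := section_map_surj fP v.
  have [b Nb <-] := section_map_surj fP w; have NVb := subgroupV sN Nb.
  rewrite /u -section_mapV // -(section_mapM fP) // !tf //; last exact: subgroupM.
  have Nbx : N (b ^ x) by apply: nN.
  rewrite conjMg conjVg (section_mapM fP (nN _ x Na) (subgroupV sN Nbx)).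
  rewrite (section_mapM fP Na NVb) !section_mapV // !opprB addrACA [RHS]addrACA.
  by congr (_ + _)%R; rewrite addrC.
exists (HB.pack_for {additive V -> V} u (GRing.isZmodMorphism.Build V V u uD)).
by move=> a Na; rewrite /= /u tf // addrC subrK.
Qed.

End SectionMap.

(** * Groups in the class S *)

Lemma class_S_normal_nilpotent (G : groupType) (N : set G) :
  class_S G -> subgroup N -> normal_set N -> N <> [set: G] ->
  nilpotent_subgroup N.
Proof.
move=> GS sN nN NT; apply: contrapT => nnil; apply: NT.
by rewrite -(GS N sN nnil) normalizer_normal.
Qed.

(* In the proof, K is generated by the u^i (f a), i > 0, and by f (x ^+ q),
   where 1 + u is the action of x; the subgroup H of the products of an element
   of K by a power of x is normalised by a. *)
Lemma class_S_section_action (G : groupType) (N I : set G) (V : zmodType)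
    (f : G -> V) (p k : nat) (x a : G) :
    class_S G -> subgroup N -> normal_set N -> normal_set I ->
    section_map N I f -> torsion_free V -> prime p -> N (x ^+ (p ^ k)) ->
    N a ->
  f (a ^ x^-1) = f a.
Proof.
move=> GS sN nN nI fP tfV p_pr Nxq Na.
(* The inverse appears because x^j b = b^(x^-j) x^j in the products that form [H]. *)
have [u fu] := section_map_normal_action sN fP x^-1 nN nI.
set q := (p ^ k)%N in Nxq; have q_gt0 : (0 < q)%N by rewrite expn_gt0 prime_gt0.
pose tau v := (v + u v)%R.
have iter_tau j b : N b -> iter j tau (f b) = f (b ^ x ^- j).
  move=> Nb; elim: j => [|j IHj]; first by rewrite expg0 invg1 conjg1.
  rewrite iterS IHj /tau -fu; last exact: nN.
  by rewrite -conjgM -invgM -expgS.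
have tauq w : iter q tau w = w.
  have [b Nb <-] := section_map_surj fP w; rewrite iter_tau //.
  by apply: (section_mapJ sN fP) => //; apply: subgroupV.
suff uv0 : u (f a) = 0%R by rewrite fu // uv0 addr0.
set v := f a; set e := u v; pose w := f (x ^+ q).
have xfix j : (x ^+ j) ^ x^-1 = x ^+ j.
  by rewrite conjXg /conjg mulgV mulg1 invgK.
have Nu b : N b -> N (b ^ x^-1 / b) /\ f (b ^ x^-1 / b) = u (f b).
  move=> Nb; have NVb := subgroupV sN Nb; have Nbx := nN _ x^-1 Nb.
  split; first exact: subgroupM.
  by rewrite (section_mapM fP Nbx NVb) (section_mapV sN fP) // fu // addrC addKr.
have uX j : N (x ^+ j) -> u (f (x ^+ j)) = 0%R.
  move=> Nxj; apply: (@addrI _ (f (x ^+ j))).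
  by rewrite addr0 -fu // xfix.
(* The multiples of [w] are there to make [H] closed under inverses. *)
pose K t := exists n (c : nat -> int) (m : int),
  t = (\sum_(i < n) iter i.+1 u v *~ c i + w *~ m)%R.
have KE t : K t -> exists n (c : nat -> int),
    u t = (\sum_(i < n) iter i.+1 u e *~ c i)%R.
  move=> [n [c [m ->]]]; exists n, c.
  rewrite raddfD raddf_sum raddfMz uX // mul0rz addr0; apply: eq_bigr => i _.
  by rewrite raddfMz /e -[u v]/(iter 1 u v) -iterD addn1 -iterS.
have K0 : K 0%R.
  by exists 0%N, (fun=> 0%R), 0%R; rewrite big_ord0 mulr0z addr0.
have KD s t : K s -> K t -> K (s + t)%R.
  have ext n (c : nat -> int) n' : (n <= n')%N ->
      (\sum_(i < n) iter i.+1 u v *~ c i =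
       \sum_(i < n') iter i.+1 u v *~ (if (i < n)%N then c i else 0))%R.
    move=> le_nn'; rewrite (big_ord_widen n' (fun i => iter i.+1 u v *~ c i)%R) //.
    rewrite big_mkcond; apply: eq_bigr => i _; case: (i < n)%N => //.
  move=> [n [c [m ->]]] [n' [c' [m' ->]]].
  rewrite (ext n c (maxn n n')) ?leq_maxl // (ext n' c' (maxn n n')) ?leq_maxr //.
  exists (maxn n n'), (fun i => (if (i < n)%N then c i else 0) +
                                (if (i < n')%N then c' i else 0))%R, (m + m')%R.
  rewrite addrACA -big_split mulrzDr; congr (_ + _)%R.
  by apply: eq_bigr => i _; rewrite mulrzDr.
have KMz t (l : int) : K t -> K (t *~ l)%R.
  move=> [n [c [m ->]]]; exists n, (fun i => c i * l)%R, (m * l)%R.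
  rewrite mulrzDl mulrz_suml mulrzA; congr (_ + _)%R.
  by apply: eq_bigr => i _; rewrite mulrzA.
have KN t : K t -> K (- t)%R by rewrite -[(- t)%R]mulrN1z; apply: KMz.
have Kiter i : K (iter i.+1 u v).
  exists i.+1, (fun j => (j == i)%:Z%R), 0%R.
  rewrite big_ord_recr /= eqxx mulr1z mulr0z addr0 big1 ?add0r // => j _.
  by rewrite ltn_eqF // mulr0z.
have Kw : K w.
  by exists 0%N, (fun=> 0%R), 1%R; rewrite big_ord0 mulr1z add0r.
have Ksum n (F : 'I_n -> V) : (forall i, K (F i)) -> K (\sum_i F i)%R.
  by move=> KF; elim/big_ind: _.
have Ku t : K t -> K (u t).
  move=> /KE[n [c ->]]; apply: Ksum => i; apply: KMz.
  by rewrite /e -[u v]/(iter 1 u v) -iterD addn1; apply: Kiter.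
have Ktau j t : K t -> K (iter j tau t).
  by move=> Kt; elim: j => //= j Kj; apply: (KD) => //; apply: Ku.
(* This congruence modulo [K] is what makes [a] normalise [H]. *)
have Kv j : K (iter j tau v - v)%R.
  elim: j => [|j IHj]; first by rewrite subrr.
  rewrite iterS /tau addrAC; apply: (KD) => //.
  rewrite -[iter j _ v](subrK v) raddfD; apply: (KD); first exact: Ku.
  exact: (Kiter 0%N).
pose H : set G := [set h | exists b j, [/\ N b, K (f b) & h = b * x ^+ j]].
have NX b j : N b -> N (b ^ x ^- j) by apply: nN.
have HM h h' : H h -> H h' -> H (h * h').
  move=> [b [j [Nb Kb ->]]] [b' [j' [Nb' Kb' ->]]]; have Nbj' := NX _ j Nb'.
  exists (b * b' ^ x ^- j), (j + j')%N; split; first exact: subgroupM.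
    rewrite (section_mapM fP Nb (NX _ j Nb')) -iter_tau //.
    by apply: (KD) => //; apply: Ktau.
  by rewrite /conjg invgK expgnDr !mulgA mulgVK.
have HV h : H h -> H h^-1.
  move=> [b [j [Nb Kb ->]]]; have NVb := subgroupV sN Nb.
  have Nxqj : N ((x ^+ q) ^+ j) by apply: subgroupX.
  have NVxqj := subgroupV sN Nxqj.
  (* Exponents in [H] are natural numbers, so x^-j is written as x^(-qj) x^l; the image of x^(-qj)
     is a multiple of [w]. *)
  set l := (q.-1 * j)%N; have NbX := NX _ l NVb.
  exists ((x ^+ q) ^- j * (b^-1) ^ x ^- l), l; split; first exact: subgroupM.
    rewrite (section_mapM fP NVxqj NbX) -iter_tau // !(section_mapV sN fP) //.
    rewrite (section_mapX sN fP) //; apply: (KD); last exact/Ktau/KN.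
    by apply: KN; rewrite pmulrn; apply: KMz.
  have -> : (x ^+ q) ^- j = x ^- j / x ^+ l.
    by rewrite -invgM -expgnDr -expgnA /l -{1}(prednK q_gt0) mulSn addnC.
  by rewrite /conjg invgK !mulgA !mulgVK invgM.
have sH : subgroup H.
  apply/subgroupP; split=> [|h h' Hh Hh']; last by apply: HM => //; apply: HV.
  exists 1, 0%N; rewrite (section_map1 sN fP) expg0 mulg1; split=> //.
  exact: subgroup1.
have [[c Hc]|Hnnil] := pselect (nilpotent_subgroup H).
  (* Applying [u] amounts to a commutator with x^-1, so u^m e comes from the m-th lower central term
     of [H]; hence u^(c+1) v = 0. *)
  suff iter_e m : exists b, [/\ N b, lower_central_series H m b & f b = iter m u e].
    have [b [_ + fb]] := iter_e c; rewrite Hc => b1.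
    apply: (unipotent_torsion_trivial tfV q_gt0 tauq (c := c.+1)).
    by rewrite iterSr -/e -fb b1 (section_map1 sN fP).
  elim: m => [|m [b [Nb Hb fb]]].
    have [Naa faa] := Nu _ Na.
    exists (a ^ x^-1 / a); split=> //=.
    exists (a ^ x^-1 / a), 0%N; rewrite faa expg0 mulg1; split=> //.
    exact: (Kiter 0%N).
  have Hx : H x^-1.
    apply: HV; exists 1, 1%N; rewrite (section_map1 sN fP) mul1g expg1.
    by split=> //; apply: subgroup1.
  exists (b ^ x^-1 / b); split.
  - exact: (Nu b Nb).1.
  - have -> : b ^ x^-1 / b = [~ b^-1, x^-1]^-1.
      by rewrite invgR /commg /conjg !invgK !mulgA.
    apply: (subgroupV (commutator_subgroup_subgroup _ _)).
    by apply: mem_commutator => //; apply: subgroupV Hb; apply: lcs_subgroup.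
  - by rewrite (Nu b Nb).2 fb.
have Ha : H a.
  rewrite -(GS H sH Hnnil).
  have HJ a' : N a' -> (forall j, K (iter j tau (f a') - f a')%R) ->
      forall h, H h -> H (h ^ a').
    move=> Na' Ka' _ [b [j [Nb Kb ->]]]; have NVa' := subgroupV sN Na'.
    exists (a'^-1 * b * a' ^ x ^- j), j; split.
    - by apply: subgroupM => //; [apply: subgroupM|apply: NX].
    - have Nab : N (a'^-1 * b) by apply: subgroupM.
      rewrite (section_mapM fP Nab (NX _ j Na')) (section_mapM fP NVa' Nb).
      rewrite (section_mapV sN fP Na') -iter_tau //.
      by rewrite addrAC [(- _ + _)%R]addrC; apply: (KD).
    - by rewrite /conjg invgK !mulgA mulgVK.
  apply: normalizer_mem; apply: HJ => //; first exact: subgroupV.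
  move=> j; rewrite (section_mapV sN fP) //.
  suff -> : iter j tau (- f a)%R = (- iter j tau v)%R by rewrite -opprD; apply: KN.
  by elim: j => //= j ->; rewrite /tau raddfN opprD.
(* Since a = b x^j, the power x^j lies in [N] and [u] kills its image. Thus e = u (f b), which [KE]
   places in u Z[u]e. *)
have [b [j [Nb Kb aE]]] := Ha.
have xjE : x ^+ j = b^-1 * a by rewrite aE mulKg.
have Nxj : N (x ^+ j).
  by rewrite xjE; apply: subgroupM => //; apply: subgroupV.
have [n [c uvE]] := KE _ Kb.
apply: (unipotent_generator_trivial tfV p_pr tauq (n := n) (c := c)).
by rewrite -uvE /e /v aE (section_mapM fP) // raddfD uX // addr0.
Qed.

(** Modulo the term i+2, the term i+1 is abelian and generated by the [a, b] with a in the term i.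
    If a^n is in the term i+1, then n [a, b] = [a^n, b] vanishes there. *)
Lemma lcs_torsion (G : groupType) (N : set G) :
    subgroup N -> normal_set N ->
    (forall a, N a ->
       exists2 n, (0 < n)%N & lower_central_series N 1 (a ^+ n)) ->
  forall i a, lower_central_series N i a ->
    exists2 n, (0 < n)%N & lower_central_series N i.+1 (a ^+ n).
Proof.
move=> sN nN tors; elim=> [|i IHi]; first exact: tors.
set C := lower_central_series N i.+1; set L := lower_central_series N i.+2.
have sC : subgroup C by apply: lcs_subgroup.
have sL : subgroup L by apply: lcs_subgroup.
have nC : normal_set C by apply: lcs_normal.
have lcsN j : lower_central_series N j `<=` N.
  by elim: j => //= j IHj x /(lcsS_sub sN nN)/IHj.
have CL a b : C a -> N b -> L [~ a, b] by apply: mem_commutator.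
have LC : L `<=` C by apply: lcsS_sub.
have [V [f fP]] := abelian_section sC sL (fun a b Ca Cb => CL a b Ca (lcsN _ _ Cb)).
suff CT : C `<=` [set a | C a /\ exists2 n, (0 < n)%N & (f a *+ n = 0)%R].
  move=> a /CT[Ca [n n_gt0 an]]; exists n => //.
  by apply/(section_map_eq0 fP (subgroupX n sC Ca)); rewrite (section_mapX sC fP).
apply: commutator_subset; first exact: (section_torsion_subgroup sC fP).
move=> a b Ha Nb; have Cab : C [~ a, b] by apply: mem_commutator.
have [n n_gt0 Can] := IHi a Ha; split=> //; exists n => //.
have [|_ <-] := section_map_commX sC fP n _ Cab.
  move=> c Cc; split; first exact: nC.
  have Lca := CL _ _ Cc (lcsN _ _ Ha); have Cca := LC _ Lca.
  rewrite -[c ^ a](mulVKg c) -commgEl (section_mapM fP Cc Cca).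
  by rewrite ((section_map_eq0 fP Cca).2 Lca) addr0.
by have Lab := CL _ _ Can Nb; apply/(section_map_eq0 fP (LC _ Lab)).
Qed.

Lemma class_S_abelianization_primary (G : groupType) :
    class_S G -> soluble_group G -> ~ nilpotent_group G ->
  let D := commutator_subgroup [set: G] [set: G] in
  nilpotent_subgroup D /\
  exists2 p, prime p & forall g, exists k, D (g ^+ (p ^ k)).
Proof.
move=> GS [d Gd] Gnnil D.
have sT : subgroup [set: G] by apply: subgroupT.
have sD : subgroup D by apply: commutator_subgroup_subgroup.
have nD : normal_set D by apply: commutator_normal.
have DG g h : D [~ g, h] by apply: mem_commutator.
(* If D = G, the derived series is constant, so [G] is trivial by solubility. *)
have DT : D <> [set: G].
  move=> DT; apply: Gnnil; exists 0%N; rewrite /= -Gd.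
  by elim: d {Gd} => //= d <-.
split; first exact: class_S_normal_nilpotent.
have [V [f fP]] := abelian_section sT sD (fun a b _ _ => DG a b).
have fM a b : f (a * b) = (f a + f b)%R by apply: (section_mapM fP).
have fV a : f a^-1 = (- f a)%R by apply: (section_mapV sT fP).
have f1 := section_map1 sT fP.
have f0 g : f g = 0%R <-> D g by apply: (section_map_eq0 fP).
have fR g h : f [~ g, h] = 0%R by apply/f0.
have fS v : exists a, f a = v by have [a _] := section_map_surj fP v; exists a.
have [|P Q sP sQ PQ|p p_pr pk] := @primary_of_indecomposable V.
- apply: contrapT => V0; apply: DT; apply/seteqP; split=> // g _; apply/f0.
  by apply: contrapT => /eqP fg; apply: V0; exists (f g).
- have pre_subgroup R : subzmod R -> subgroup [set g | R (f g)].
    move=> sR; apply/subgroupP; rewrite /= f1; split=> [|a b Ra Rb]; first exact: sR.1.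
    by rewrite fM fV; apply: sR.2.
  have pre_normal (R : set V) : normal_set [set g | R (f g)].
    by move=> a g /=; rewrite -[a ^ g](mulVKg a) -commgEl fM fR addr0.
  have pre_nilpotent R : subzmod R -> ~ (forall v, R v) ->
      nilpotent_subgroup [set g | R (f g)].
    move=> sR RV; apply: class_S_normal_nilpotent => //; first exact: pre_subgroup.
    move=> RT; apply: RV => v; have [g <-] := fS v.
    by rewrite -[R _]/([set g | R (f g)] g) RT.
  (* Two proper subgroups with sum [V] have nilpotent normal preimages with product [G], so
     Fitting's theorem would make [G] nilpotent. *)
  apply: contrapT => /not_orP[PV QV]; apply: Gnnil.
  apply: (@nilpotent_product G [set g | P (f g)] [set g | Q (f g)]).
  + exact: pre_subgroup.
  + exact: pre_normal.
  + exact: pre_nilpotent.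
  + exact: pre_subgroup.
  + exact: pre_normal.
  + exact: pre_nilpotent.
  + move=> g; have [v [w [Pv Qw fg]]] := PQ (f g); have [a fa] := fS v.
    exists a, (a^-1 * g); split=> /=; rewrite ?fa ?mulVKg //.
    by rewrite fM fV fg fa addKr.
  + by move=> g h; rewrite /= fR; apply: sP.1.
- exists p => // g; have [k] := pk (f g).
  by rewrite -(section_mapX sT fP) // => /f0; exists k.
Qed.

Theorem theorem3p3 (G : groupType)
    (hnonperiodic : ~ periodic_group G) (hsoluble : soluble_group G) :
  class_S G <-> nilpotent_group G.
Proof.
split=> [GS|Gnil H sH Hnnil]; last first.
  by case: Hnnil; apply: nilpotent_subset Gnil.
apply: contrapT => Gnnil; apply: hnonperiodic.
have [[c Nc] [p p_pr Gp]] := class_S_abelianization_primary GS hsoluble Gnnil.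
set N := commutator_subgroup _ _ in Nc Gp.
have sN : subgroup N by apply: commutator_subgroup_subgroup.
have nN : normal_set N by apply: commutator_normal.
pose L := lower_central_series N 1.
have sL : subgroup L by apply: lcs_subgroup.
have NL a b : N a -> N b -> L [~ a, b] by apply: mem_commutator.
have [V0 [f0 f0P]] := abelian_section sN sL NL.
(* The preimage in G' of the torsion of G'/G''. *)
pose I := [set a | N a /\ exists2 n, (0 < n)%N & (f0 a *+ n = 0)%R].
have NX a n (Na : N a) : N (a ^+ n) := subgroupX n sN Na.
have IE a : I a <-> N a /\ exists2 n, (0 < n)%N & L (a ^+ n).
  split=> -[Na [n n0 an]]; split=> //; exists n => //.
    by apply/(section_map_eq0 f0P (NX a n Na)); rewrite (section_mapX sN f0P).
  by rewrite -(section_mapX sN f0P) //; apply/(section_map_eq0 f0P (NX a n Na)).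
have sI : subgroup I by apply: (section_torsion_subgroup sN f0P).
have nI : normal_set I.
  move=> a g /IE[Na [n n0 an]]; apply/IE; split; first exact: nN.
  by exists n => //; rewrite -conjXg; apply: (lcs_normal (n := 1) nN).
have NI a b : N a -> N b -> I [~ a, b].
  move=> Na Nb; apply/IE; split; last by exists 1%N; rewrite // expg1; apply: NL.
  by apply: (commutator_subl sN nN); apply: NL.
have [V [f fP]] := abelian_section sN sI NI.
have tfV : torsion_free V.
  move=> v n n0 vn; have [a Na fa] := section_map_surj fP v.
  rewrite -fa; apply/(section_map_eq0 fP) => //; apply/IE; split=> //.
  move: vn; rewrite -fa -(section_mapX sN fP) //.
  move=> /(section_map_eq0 fP (NX a n Na))/IE[_ [m m0 anm]].
  by exists (n * m)%N; rewrite ?muln_gt0 ?n0 // expgnA.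
have fJ x a : N a -> f (a ^ x) = f a.
  move=> Na; have [k Gpk] := Gp x^-1; rewrite -[x]invgK.
  exact: class_S_section_action GS sN nN nI fP tfV p_pr Gpk Na.
(* With c = g^(p^k) in [N], p^k f [g, h] = f [c, h] = f (c^h) - f c = 0, and [V] is torsion-free. *)
have Nsub : N `<=` I.
  apply: commutator_subset => // g h _ _.
  have Ngh : N [~ g, h] by apply: mem_commutator.
  have [k Ngk] := Gp g.
  have [|_ fgk] := section_map_commX sN fP (p ^ k) _ Ngh.
    by move=> a Na; split; [apply: nN|apply: fJ].
  apply/(section_map_eq0 fP) => //.
  apply: (tfV _ (p ^ k)%N); first by rewrite expn_gt0 prime_gt0.
  rewrite -fgk commgEl.
  rewrite (section_mapM fP (subgroupV sN Ngk) (nN _ h Ngk)) (section_mapV sN fP) //.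
  by rewrite fJ // addNr.
have tors : forall i a, lower_central_series N i a ->
    exists2 n, (0 < n)%N & lower_central_series N i.+1 (a ^+ n).
  by apply: lcs_torsion => // a /Nsub/IE[].
(* Powers descend the series one term at a time; its term of index [c] is trivial, so [N] is
   periodic. *)
have Nper i a : N a -> exists2 n, (0 < n)%N & lower_central_series N i (a ^+ n).
  move=> Na; elim: i => [|i [n n0 an]]; first by exists 1%N.
  have [m m0 anm] := tors _ _ an.
  by exists (n * m)%N; rewrite ?muln_gt0 ?n0 // expgnA.
move=> g; have [k Ngk] := Gp g; have [n n0] := Nper c _ Ngk.
rewrite Nc => gkn; exists (p ^ k * n)%N; last by rewrite expgnA.
by rewrite muln_gt0 n0 expn_gt0 prime_gt0.
Qed.
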